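(* Let $A{_\tau\times_\sigma}B$ be a smash biproduct bialgebra for which $\sigma$ is right conormal. Suppose that $\mathcal R=\sum\mathcal R^1\otimes\mathcal R^2\otimes\mathcal R^3\otimes\mathcal R^4\in(A{_\tau\times_\sigma}B)\otimes(A{_\tau\times_\sigma}B)$ is a quasitriangular structure of $A{_\tau\times_\sigma}B$, and let $W\in B\otimes B$, $X\in A\otimes B$, $Y\in B\otimes A$, $Z\in A\otimes A$ be the factor elements of $\mathcal R$. Then $$\mathcal R=\sum Z^1_{\tau_1\tau_2}\bar X^1_{\tau_3}X^1\otimes W^1Y^1\otimes Z^2Y^2_{\sigma_1\sigma_2}\,\epsilon_B(1_{B\tau_1\sigma_2}\bar X^2_{\sigma_1})\otimes 1_{B\tau_2}1_{B\tau_3}X^2W^2.$$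
   Context: Everything is over a field $\Bbbk$. Algebras are associative and unital, coalgebras coassociative and counital; $\Delta(c)=\sum c_{(1)}\otimes c_{(2)}$. Smash product: for algebras $A,B$ and a linear map $\sigma:B\otimes A\to A\otimes B$, written $\sigma(b\otimes a)=\sum a_\sigma\otimes b_\sigma$, consider on $A\otimes B$ the multiplication $(a\otimes b)(a'\otimes b')=\sum aa'_\sigma\otimes b_\sigma b'$. If it is associative with unit $1_A\otimes 1_B$, this algebra is the smash product $A\#_\sigma B$. Smash coproduct: for coalgebras $A,B$ and a linear map $\tau:A\otimes B\to B\otimes A$, written $\tau(a\otimes b)=\sum b_\tau\otimes a_\tau$, consider on $A\otimes B$ the comultiplication $a\otimes b\mapsto\sum a_{(1)}\otimes b_{(1)\tau}\otimes a_{(2)\tau}\otimes b_{(2)}$. If it is coassociative with counit $\epsilon_A\otimes\epsilon_B$, this coalgebra is the smash coproduct $A{_\tau\ltimes}B$. Smash biproduct: if $A,B$ are both algebras and coalgebras (neither necessarily a bialgebra), $A\#_\sigma B$ is a smash product, $A{_\tau\ltimes}B$ is a smash coproduct, and $A\otimes B$ with these two structures is a bialgebra, this bialgebra is denoted $A{_\tau\times_\sigma}B$ and called a smash biproduct bialgebra. Standing assumption: for every smash biproduct bialgebra, $A$ and $B$ are counital algebras via $\epsilon_A,\epsilon_B$ (i.e. $\epsilon_A,\epsilon_B$ are algebra maps to $\Bbbk$) and unital coalgebras via $\eta_A,\eta_B$ (i.e. the unit maps $\Bbbk\to A$, $\Bbbk\to B$ are coalgebra maps). $\sigma$ is right conormal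 if $\sum\epsilon_A(a_\sigma)b_\sigma=\epsilon_A(a)b$ for all $a\in A,b\in B$. A quasitriangular structure of a bialgebra $H$ is an element $\mathcal R=\sum\mathcal R^1\otimes\mathcal R^2\in H\otimes H$ (not required invertible) with: (QT1) $(\epsilon_H\otimes id)(\mathcal R)=1_H=(id\otimes\epsilon_H)(\mathcal R)$; (QT2) $(\Delta_H\otimes id)(\mathcal R)=\mathcal R_{13}\mathcal R_{23}$; (QT3) $(id\otimes\Delta_H)(\mathcal R)=\mathcal R_{13}\mathcal R_{12}$; (QT4) $\mathcal R\Delta_H(h)=\Delta_H^{cop}(h)\mathcal R$ for all $h\in H$. For $H=A{_\tau\times_\sigma}B$, $H\otimes H=A\otimes B\otimes A\otimes B$. Factor elements of $\mathcal R$: with $\pi_A=id_A\otimes\epsilon_B:A{_\tau\times_\sigma}B\to A$ and $\pi_B=\epsilon_A\otimes id_B:A{_\tau\times_\sigma}B\to B$, set $W=\sum W^1\otimes W^2=(\pi_B\otimes\pi_B)(\mathcal R)$, $X=\sum X^1\otimes X^2=(\pi_A\otimes\pi_B)(\mathcal R)$, $Y=\sum Y^1\otimes Y^2=(\pi_B\otimes\pi_A)(\mathcal R)$, $Z=\sum Z^1\otimes Z^2=(\pi_A\otimes\pi_A)(\mathcal R)$. Index notation: $\sigma_i$ (resp. $\tau_i$) is a copy of $\sigma$ (resp. $\tau$). If an index $\sigma_i$ appears on an element coming from $B$ and on an element coming from $A$, then $\sigma_i$ has been applied to ($B$-element)$\otimes$($A$-element); similarly $\tau_i$ is applied to ($A$-element)$\otimes$($B$-element).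 Several subscripts on one element are applied successively from left to right. Each occurrence of $1_B$ carries its own indices. $\bar X=\sum\bar X^1\otimes\bar X^2$ is another copy of $X$. In the formula: $\tau_1$ is applied to $Z^1\otimes 1_B$, then $\tau_2$ to $Z^1_{\tau_1}\otimes 1_B$; $\tau_3$ is applied to $\bar X^1\otimes 1_B$; $\sigma_1$ is applied to $\bar X^2\otimes Y^2$, then $\sigma_2$ to $1_{B\tau_1}\otimes Y^2_{\sigma_1}$. *)

(* Defs.v *)
From HB Require Import structures.
From mathcomp Require Import all_boot all_algebra.
From mathcomp Require Import boolp.

Set Implicit Arguments.
Unset Strict Implicit.
Unset Printing Implicit Defensive.

Import GRing.Theory.
Local Open Scope ring_scope.
Local Open Scope quotient_scope.

Notation bilinear_map f := (bilinear_for *:%R *:%R f).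

Section Tensor.
Variables (k : fieldType) (U V : lmodType k).
Implicit Types (u : U) (v : V) (s t : seq (U * V)).

(* A sequence [:: (u1, v1); ...; (un, vn)] stands for the formal sum of the   *)
(* symbols ui ⊗ vi; tens_eqv is the congruence on formal sums generated by    *)
(* the defining relations of the tensor product.                              *)
Inductive tens_eqv : seq (U * V) -> seq (U * V) -> Prop :=
| tens_eqv_refl s : tens_eqv s s
| tens_eqv_sym s t : tens_eqv s t -> tens_eqv t s
| tens_eqv_trans s t r : tens_eqv s t -> tens_eqv t r -> tens_eqv s r
| tens_eqv_cat s t r : tens_eqv s t -> tens_eqv (s ++ r) (t ++ r)
| tens_eqv_catC s t : tens_eqv (s ++ t) (t ++ s)
| tens_eqv0 v : tens_eqv [:: (0, v)] [::]
| tens_eqvDl u u' v : tens_eqv [:: (u + u', v)] [:: (u, v); (u', v)]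
| tens_eqvDr u v v' : tens_eqv [:: (u, v + v')] [:: (u, v); (u, v')]
| tens_eqvZ a u v : tens_eqv [:: (a *: u, v)] [:: (u, a *: v)].

Definition tens_eqvb s t := `[< tens_eqv s t >].

Lemma tens_eqvb_equiv : equiv_class_of tens_eqvb.
Proof.
split=> [s|s t|t s r].
- by apply/asboolP; constructor.
- by apply/idP/idP=> /asboolP st; apply/asboolP/tens_eqv_sym.
- by move=> /asboolP st /asboolP tr; apply/asboolP/(tens_eqv_trans st tr).
Qed.

Canonical tens_equiv := EquivRelPack tens_eqvb_equiv.
Canonical tens_encModRel := defaultEncModRel tens_eqvb.

Definition tens := {eq_quot tens_eqvb}.
HB.instance Definition _ : EqQuotient _ tens_eqvb tens := EqQuotient.on tens.
HB.instance Definition _ := Choice.on tens.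

Lemma tens_piP s t : \pi_tens s = \pi_tens t <-> tens_eqv s t.
Proof.
split=> [/eqmodP /asboolP //|st].
by apply/eqmodP/asboolP.
Qed.

Lemma tens_repr_pi s : tens_eqv (repr (\pi_tens s)) s.
Proof. by apply/tens_piP; rewrite reprK. Qed.

Lemma tens_eqv_catl s t r : tens_eqv s t -> tens_eqv (r ++ s) (r ++ t).
Proof.
move=> st; apply: tens_eqv_trans (tens_eqv_catC _ _) _.
exact: tens_eqv_trans (tens_eqv_cat _ st) (tens_eqv_catC _ _).
Qed.

Lemma tens_eqv_cat2 s s' t t' :
  tens_eqv s s' -> tens_eqv t t' -> tens_eqv (s ++ t) (s' ++ t').
Proof.
by move=> ss' tt'; apply: tens_eqv_trans (tens_eqv_cat _ ss') (tens_eqv_catl _ tt').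
Qed.

Definition tens_zero : tens := \pi_tens [::].
Definition tens_add (x y : tens) : tens := \pi_tens (repr x ++ repr y).
Definition tens_scale (a : k) (x : tens) : tens :=
  \pi_tens [seq (a *: p.1, p.2) | p <- repr x].
Definition tens_opp (x : tens) : tens := tens_scale (-1) x.

Lemma tens_pi_ind (P : tens -> Prop) : (forall s, P (\pi_tens s)) -> forall x, P x.
Proof. by move=> Ps x; rewrite -[x]reprK. Qed.

Lemma tens_add_pi s t : tens_add (\pi_tens s) (\pi_tens t) = \pi_tens (s ++ t).
Proof. by apply/tens_piP/tens_eqv_cat2; apply: tens_repr_pi. Qed.

Lemma tens_eqv_scale a s t : tens_eqv s t ->
  tens_eqv [seq (a *: p.1, p.2) | p <- s] [seq (a *: p.1, p.2) | p <- t].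
Proof.
elim=> {s t} [s|s t _|s t r _ + _|s t r _ st|s t|v|u u' v|u v v'|b u v] /=.
- exact: tens_eqv_refl.
- exact: tens_eqv_sym.
- exact: tens_eqv_trans.
- by rewrite !map_cat; apply: tens_eqv_cat.
- by rewrite !map_cat; apply: tens_eqv_catC.
- by rewrite scaler0; apply: tens_eqv0.
- by rewrite scalerDr; apply: tens_eqvDl.
- exact: tens_eqvDr.
- by rewrite scalerA mulrC -scalerA; apply: tens_eqvZ.
Qed.

Lemma tens_scale_pi a s :
  tens_scale a (\pi_tens s) = \pi_tens [seq (a *: p.1, p.2) | p <- s].
Proof. by apply/tens_piP/tens_eqv_scale/tens_repr_pi. Qed.

Lemma tens_addA : associative tens_add.
Proof.
elim/tens_pi_ind=> s; elim/tens_pi_ind=> t; elim/tens_pi_ind=> r.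
by rewrite !tens_add_pi catA.
Qed.

Lemma tens_addC : commutative tens_add.
Proof.
elim/tens_pi_ind=> s; elim/tens_pi_ind=> t; rewrite !tens_add_pi.
exact/tens_piP/tens_eqv_catC.
Qed.

Lemma tens_add0 : left_id tens_zero tens_add.
Proof. by elim/tens_pi_ind=> s; rewrite tens_add_pi. Qed.

Lemma tens_scaleDl x : {morph tens_scale^~ x : a b / a + b >-> tens_add a b}.
Proof.
elim/tens_pi_ind: x => s a b; rewrite !tens_scale_pi tens_add_pi.
apply/tens_piP; elim: s => [|[u v] s IHs] /=; first exact: tens_eqv_refl.
have st : tens_eqv ([:: ((a + b) *: u, v)] ++ [seq ((a + b) *: p.1, p.2) | p <- s])
   ([:: (a *: u, v); (b *: u, v)] ++
    ([seq (a *: p.1, p.2) | p <- s] ++ [seq (b *: p.1, p.2) | p <- s])).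
  by apply: tens_eqv_cat2 IHs; rewrite scalerDl; apply: tens_eqvDl.
apply: tens_eqv_trans st _.
rewrite -(cat1s (a *: u, v)) -(cat1s (b *: u, v) [::]) -[X in tens_eqv _ X]cat1s.
rewrite -(cat1s (b *: u, v) (map _ _)) cats0 -!catA; apply: tens_eqv_catl.
by rewrite !catA; apply/tens_eqv_cat/tens_eqv_catC.
Qed.

Lemma tens_scale0 x : tens_scale 0 x = tens_zero.
Proof.
elim/tens_pi_ind: x => s; rewrite tens_scale_pi; apply/tens_piP.
elim: s => [|[u v] s IHs] /=; first exact: tens_eqv_refl.
rewrite -cat1s; apply: (@tens_eqv_cat2 _ [::] _ [::]) => //.
by rewrite scale0r; apply: tens_eqv0.
Qed.

Lemma tens_scale1 : left_id 1 tens_scale.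
Proof.
elim/tens_pi_ind=> s; rewrite tens_scale_pi; congr (\pi_tens _).
by rewrite -[RHS]map_id; apply: eq_map => -[u v] /=; rewrite scale1r.
Qed.

Lemma tens_addN : left_inverse tens_zero tens_opp tens_add.
Proof.
by move=> x; rewrite -{2}[x]tens_scale1 -tens_scaleDl addNr tens_scale0.
Qed.

HB.instance Definition _ :=
  GRing.isZmodule.Build tens tens_addA tens_addC tens_add0 tens_addN.

Lemma tens_scaleA a b x : tens_scale a (tens_scale b x) = tens_scale (a * b) x.
Proof.
elim/tens_pi_ind: x => s; rewrite !tens_scale_pi -map_comp; congr (\pi_tens _).
by apply: eq_map => -[u v] /=; rewrite scalerA.
Qed.

Lemma tens_scaleDr : right_distributive tens_scale +%R.
Proof.
move=> a; elim/tens_pi_ind=> s; elim/tens_pi_ind=> t.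
change (tens_scale a (tens_add (\pi_tens s) (\pi_tens t)) =
  tens_add (tens_scale a (\pi_tens s)) (tens_scale a (\pi_tens t))).
by rewrite tens_add_pi !tens_scale_pi tens_add_pi map_cat.
Qed.

HB.instance Definition _ := GRing.Zmodule_isLmodule.Build k tens
  tens_scaleA tens_scale1 tens_scaleDr tens_scaleDl.

Definition tpure u v : tens := \pi_tens [:: (u, v)].

Lemma tpure_bilinear : bilinear_map tpure.
Proof.
split=> [v a u u'|u a v v'].
- change (tpure (a *: u + u') v = tens_add (tens_scale a (tpure u v)) (tpure u' v)).
  rewrite /tpure tens_scale_pi tens_add_pi; exact/tens_piP/tens_eqvDl.
- change (tpure u (a *: v + v') = tens_add (tens_scale a (tpure u v)) (tpure u v')).
  rewrite /tpure tens_scale_pi tens_add_pi; apply/tens_piP.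
  apply: tens_eqv_trans (tens_eqvDr _ _ _) _; rewrite -cat1s.
  exact/tens_eqv_cat/tens_eqv_sym/tens_eqvZ.
Qed.

HB.instance Definition _ :=
  bilinear_isBilinear.Build k U V tens *:%R *:%R tpure tpure_bilinear.

Lemma tens_pi_sum s : \pi_tens s = \sum_(p <- s) tpure p.1 p.2.
Proof.
elim: s => [|[u v] s IHs]; first by rewrite big_nil.
by rewrite big_cons -IHs -cat1s -tens_add_pi.
Qed.

Lemma tens_sum_repr (x : tens) : x = \sum_(p <- repr x) tpure p.1 p.2.
Proof. by rewrite -tens_pi_sum reprK. Qed.

End Tensor.

Notation "U ⊗ V" := (tens U%type V%type) (at level 40, left associativity) : type_scope.
Notation "u ⊗ v" := (tpure u v) (at level 40, left associativity) : ring_scope.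

Section Lift.
Variables (k : fieldType) (U V W : lmodType k).

(* For bilinear f this is the linear map induced on U ⊗ V, so the value does  *)
(* not depend on the choice of representative made by repr: see tlift_pure,   *)
(* tlift_linear and tlift_unique.                                             *)
Definition tlift (f : U -> V -> W) (x : tens U V) : W :=
  \sum_(p <- repr x) f p.1 p.2.

Lemma tens_eqv_lift (f : U -> V -> W) s t : bilinear_map f -> tens_eqv s t ->
  \sum_(p <- s) f p.1 p.2 = \sum_(p <- t) f p.1 p.2.
Proof.
move=> [fl fr]; have Dl v u u' : f (u + u') v = f u v + f u' v.
  by have := fl v 1 u u'; rewrite /= !scale1r.
have Dr u v v' : f u (v + v') = f u v + f u v'.
  by have := fr u 1 v v'; rewrite /= !scale1r.
have Ol v : f 0 v = 0 by apply: (addIr (f 0 v)); rewrite -Dl !add0r.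
have Or u : f u 0 = 0 by apply: (addIr (f u 0)); rewrite -Dr !add0r.
have Zl a u v : f (a *: u) v = a *: f u v.
  by have := fl v a u 0; rewrite /= Ol !addr0.
have Zr a u v : f u (a *: v) = a *: f u v.
  by have := fr u a v 0; rewrite /= Or !addr0.
elim=> {s t} [s|s t _|s t r _ + _|s t r _ st|s t|v|u u' v|u v v'|a u v] //.
- exact: etrans.
- by rewrite !big_cat /= st.
- by rewrite !big_cat /= addrC.
- by rewrite big_seq1 big_nil /= Ol.
- by rewrite big_seq1 big_cons big_seq1 /= Dl.
- by rewrite big_seq1 big_cons big_seq1 /= Dr.
- by rewrite !big_seq1 /= Zl Zr.
Qed.

Lemma tlift_pi (f : U -> V -> W) s : bilinear_map f ->
  tlift f (\pi_(tens U V) s) = \sum_(p <- s) f p.1 p.2.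
Proof. by move=> fb; apply: tens_eqv_lift => //; apply: tens_repr_pi. Qed.

Lemma tlift_pure (f : U -> V -> W) u v : bilinear_map f -> tlift f (u ⊗ v) = f u v.
Proof. by move=> fb; rewrite tlift_pi // big_seq1. Qed.

Lemma tlift_linear (f : U -> V -> W) : bilinear_map f -> linear (tlift f).
Proof.
move=> fb a x y; elim/tens_pi_ind: x => s; elim/tens_pi_ind: y => t.
change (tlift f (tens_add (tens_scale a (\pi_(tens U V) s)) (\pi_(tens U V) t)) =
   a *: tlift f (\pi_(tens U V) s) + tlift f (\pi_(tens U V) t)).
rewrite tens_scale_pi tens_add_pi !tlift_pi // big_cat big_map /=; congr (_ + _).
rewrite scaler_sumr; apply: eq_bigr => -[u v] _ /=.
have f0 : f 0 v = 0 by have := fb.1 v (-1) u u; rewrite /= !scaleN1r !addNr.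
by have := fb.1 v a u 0; rewrite /= f0 !addr0.
Qed.

Lemma tlift_unique (g : {linear tens U V -> W}) (x : tens U V) :
  g x = tlift (fun u v => g (u ⊗ v)) x.
Proof. by rewrite {1}(tens_sum_repr x) raddf_sum. Qed.

Lemma eq_tlift (f g : U -> V -> W) : f =2 g -> tlift f =1 tlift g.
Proof. by move=> fg x; apply: eq_bigr => p _; apply: fg. Qed.

Lemma tliftP (a : k) (f g : U -> V -> W) (x : tens U V) :
  tlift (fun u v => a *: f u v + g u v) x = a *: tlift f x + tlift g x.
Proof. by rewrite /tlift big_split scaler_sumr. Qed.

End Lift.

Section LiftParam.
Variables (k : fieldType) (T U V W : lmodType k).

Lemma linear_tlift_param (f : T -> U -> V -> W) (x : tens U V) :
  (forall u v, linear (fun t => f t u v)) -> linear (fun t => tlift (f t) x).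
Proof.
by move=> fl a t t' /=; rewrite -tliftP; apply: eq_tlift => u v; apply: fl.
Qed.

Lemma linear_tlift_comp (f : U -> V -> W) (h : T -> tens U V) :
  bilinear_map f -> linear h -> linear (fun t => tlift f (h t)).
Proof. by move=> fb hl a t t'; rewrite /= hl tlift_linear. Qed.

End LiftParam.

(* \tsum_(u, v <- x) E is the Sweedler-type sum of E over x = \sum u ⊗ v.     *)
Notation "\tsum_ ( u , v <- x ) E" := (tlift (fun u v => E) x)
  (at level 41, u name, v name, x at level 50, E at level 41, right associativity,
   format "'[' \tsum_ ( u ,  v  <-  x ) '/  '  E ']'") : ring_scope.

Section Maps.
Variable k : fieldType.

Definition tmap (U V U' V' : lmodType k) (f : U -> U') (g : V -> V')
  (x : U ⊗ V) : U' ⊗ V' := \tsum_(u, v <- x) f u ⊗ g v.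

Definition tswap (U V : lmodType k) (x : U ⊗ V) : V ⊗ U :=
  \tsum_(u, v <- x) v ⊗ u.

Definition tassoc (U V W : lmodType k) (x : (U ⊗ V) ⊗ W) : U ⊗ (V ⊗ W) :=
  \tsum_(y, w <- x) \tsum_(u, v <- y) u ⊗ (v ⊗ w).

Definition tmul (U V : lmodType k) (mU : U -> U -> U) (mV : V -> V -> V)
  (x y : U ⊗ V) : U ⊗ V :=
  \tsum_(u, v <- x) \tsum_(u', v' <- y) mU u u' ⊗ mV v v'.

End Maps.

Section Structures.
Variables (k : fieldType) (H : lmodType k).

Record is_algebra (mul : {bilinear H -> H -> H}) (one : H) : Prop := {
  algebra_mulA : associative mul;
  algebra_mul1l : left_id one mul;
  algebra_mul1r : right_id one mul
}.

Record is_coalgebra (comul : {linear H -> (H ⊗ H)%type}) (counit : {scalar H}) : Prop := {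
  coalgebra_coassoc : forall h,
    tassoc (tmap comul idfun (comul h)) = tmap idfun comul (comul h);
  coalgebra_counitl : forall h, \tsum_(h1, h2 <- comul h) counit h1 *: h2 = h;
  coalgebra_counitr : forall h, \tsum_(h1, h2 <- comul h) counit h2 *: h1 = h
}.

Record is_bialgebra (mul : {bilinear H -> H -> H}) (one : H)
    (comul : {linear H -> (H ⊗ H)%type}) (counit : {scalar H}) : Prop := {
  bialgebra_algebra : is_algebra mul one;
  bialgebra_coalgebra : is_coalgebra comul counit;
  bialgebra_comulM : forall x y,
    comul (mul x y) = tmul mul mul (comul x) (comul y);
  bialgebra_comul1 : comul one = one ⊗ one;
  bialgebra_counitM : forall x y, counit (mul x y) = counit x * counit y;
  bialgebra_counit1 : counit one = 1
}.

End Structures.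

Definition counital_algebra (k : fieldType) (A : algType k)
    (counit : {scalar A}) : Prop :=
  (forall a b : A, counit (a * b) = counit a * counit b) /\ counit 1 = 1.

Definition unital_coalgebra (k : fieldType) (A : algType k)
    (comul : {linear A -> (A ⊗ A)%type}) (counit : {scalar A}) : Prop :=
  comul 1 = 1 ⊗ 1 /\ counit 1 = 1.

Section Quasitriangular.
Variables (k : fieldType) (H : lmodType k).
Variables (mul : {bilinear H -> H -> H}) (one : H).
Variables (comul : {linear H -> (H ⊗ H)%type}) (counit : {scalar H}).

Definition leg12 (R : H ⊗ H) : H ⊗ (H ⊗ H) := \tsum_(r, s <- R) r ⊗ (s ⊗ one).
Definition leg13 (R : H ⊗ H) : H ⊗ (H ⊗ H) := \tsum_(r, s <- R) r ⊗ (one ⊗ s).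
Definition leg23 (R : H ⊗ H) : H ⊗ (H ⊗ H) := \tsum_(r, s <- R) one ⊗ (r ⊗ s).

Definition mul2 : H ⊗ H -> H ⊗ H -> H ⊗ H := tmul mul mul.
Definition mul3 : H ⊗ (H ⊗ H) -> H ⊗ (H ⊗ H) -> H ⊗ (H ⊗ H) := tmul mul mul2.

Record quasitriangular (R : H ⊗ H) : Prop := {
  qt_counitl : \tsum_(r, s <- R) counit r *: s = one;
  qt_counitr : \tsum_(r, s <- R) counit s *: r = one;
  qt_comull : tassoc (tmap comul idfun R) = mul3 (leg13 R) (leg23 R);
  qt_comulr : tmap idfun comul R = mul3 (leg13 R) (leg12 R);
  qt_cop : forall h, mul2 R (comul h) = mul2 (tswap (comul h)) R
}.

End Quasitriangular.

Section Smash.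
Variables (k : fieldType) (A B : algType k).
Variables (comulA : {linear A -> (A ⊗ A)%type}) (counitA : {scalar A}).
Variables (comulB : {linear B -> (B ⊗ B)%type}) (counitB : {scalar B}).
Variables (sigma : {linear (B ⊗ A)%type -> (A ⊗ B)%type}) (tau : {linear (A ⊗ B)%type -> (B ⊗ A)%type}).

(* sigma (b ⊗ a) = \sum a_sigma ⊗ b_sigma, tau (a ⊗ b) = \sum b_tau ⊗ a_tau;  *)
(* below, bound names suffixed by s (resp. t) carry an index sigma (resp.     *)
(* tau).                                                                      *)
Definition smash_one : A ⊗ B := 1 ⊗ 1.

Definition smash_mul (x y : A ⊗ B) : A ⊗ B :=
  \tsum_(a, b <- x) \tsum_(a', b' <- y)
    \tsum_(a's, bs <- sigma (b ⊗ a')) (a * a's) ⊗ (bs * b').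

Definition smash_comul (x : A ⊗ B) : (A ⊗ B) ⊗ (A ⊗ B) :=
  \tsum_(a, b <- x) \tsum_(a1, a2 <- comulA a) \tsum_(b1, b2 <- comulB b)
    \tsum_(b1t, a2t <- tau (a2 ⊗ b1)) (a1 ⊗ b1t) ⊗ (a2t ⊗ b2).

Definition smash_counit (x : A ⊗ B) : k :=
  tlift (W := k^o) (fun a b => counitA a * counitB b) x.

Lemma smash_mul_bilinear : bilinear_map smash_mul.
Proof.
have core (a : A) (b' : B) :
    bilinear_map (fun (a's : A) (bs : B) => (a * a's) ⊗ (bs * b')).
  split=> [v c p q|u c p q].
    by rewrite mulrDr -scalerAr; apply: (tpure_bilinear _ _).1.
  by rewrite mulrDl -scalerAl; apply: (tpure_bilinear _ _).2.
split=> [y|x].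
- apply: tlift_linear; split=> [b|a].
    apply: linear_tlift_param => a' b'; apply: linear_tlift_param => a's bs c p q.
    by rewrite mulrDl -scalerAl; apply: (tpure_bilinear _ _).1.
  apply: linear_tlift_param => a' b'; apply: linear_tlift_comp => // c p q.
  by rewrite (tpure_bilinear _ _).1 linearP.
- apply: linear_tlift_param => a b; apply: tlift_linear; split=> [b'|a'].
    apply: linear_tlift_comp => // c p q.
    by rewrite (tpure_bilinear _ _).2 linearP.
  apply: linear_tlift_param => a's bs c p q.
  by rewrite mulrDr -scalerAr; apply: (tpure_bilinear _ _).2.
Qed.

Lemma smash_comul_linear : linear smash_comul.
Proof.
apply: tlift_linear; split=> [b|a].
- apply: linear_tlift_comp => [|c p q]; last by rewrite linearP.
  split=> [a2|a1].
    apply: linear_tlift_param => b1 b2; apply: linear_tlift_param => b1t a2t c p q.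
    by rewrite !(tpure_bilinear _ _).1.
  apply: linear_tlift_param => b1 b2; apply: linear_tlift_comp => [|c p q].
    split=> [v c p q|u c p q]; first by rewrite (tpure_bilinear _ _).2 (tpure_bilinear _ _).1.
    by rewrite (tpure_bilinear _ _).1 (tpure_bilinear _ _).2.
  by rewrite (tpure_bilinear _ _).1 linearP.
- apply: linear_tlift_param => a1 a2.
  apply: linear_tlift_comp => [|c p q]; last by rewrite linearP.
  split=> [b2|b1].
    apply: linear_tlift_comp => [|c p q].
      split=> [v c p q|u c p q]; first by rewrite (tpure_bilinear _ _).2 (tpure_bilinear _ _).1.
      by rewrite (tpure_bilinear _ _).1 (tpure_bilinear _ _).2.
    by rewrite (tpure_bilinear _ _).2 linearP.
  apply: linear_tlift_param => b1t a2t c p q.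
  by rewrite !(tpure_bilinear _ _).2.
Qed.

Lemma smash_counit_scalar : scalar smash_counit.
Proof.
apply: (@tlift_linear _ _ _ k^o); split=> [b|a] c p q /=.
  by rewrite linearP mulrDl -mulrA.
by rewrite linearP mulrDr mulrCA.
Qed.

HB.instance Definition _ := bilinear_isBilinear.Build
  k (A ⊗ B)%type (A ⊗ B)%type (A ⊗ B)%type *:%R *:%R smash_mul smash_mul_bilinear.
HB.instance Definition _ := GRing.isLinear.Build
  k (A ⊗ B)%type ((A ⊗ B) ⊗ (A ⊗ B))%type *:%R smash_comul smash_comul_linear.
HB.instance Definition _ := GRing.isLinear.Build
  k (A ⊗ B)%type k *%R smash_counit smash_counit_scalar.

Definition is_smash_product : Prop := is_algebra smash_mul smash_one.

Definition is_smash_coproduct : Prop := is_coalgebra smash_comul smash_counit.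

(* Beyond the bialgebra axioms on A ⊗ B, the last four fields require the     *)
(* counits of A and B to be algebra maps and their units coalgebra maps.      *)
Record smash_biproduct_bialgebra : Prop := {
  smash_coalgebraA : is_coalgebra comulA counitA;
  smash_coalgebraB : is_coalgebra comulB counitB;
  smash_product : is_smash_product;
  smash_coproduct : is_smash_coproduct;
  smash_bialgebra :
    is_bialgebra smash_mul smash_one smash_comul smash_counit;
  smash_counitalA : counital_algebra counitA;
  smash_counitalB : counital_algebra counitB;
  smash_unitalA : unital_coalgebra comulA counitA;
  smash_unitalB : unital_coalgebra comulB counitB
}.

Definition right_conormal : Prop := forall (a : A) (b : B),
  \tsum_(a_s, b_s <- sigma (b ⊗ a)) counitA a_s *: b_s = counitA a *: b.

Definition piA (x : A ⊗ B) : A := \tsum_(a, b <- x) counitB b *: a.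
Definition piB (x : A ⊗ B) : B := \tsum_(a, b <- x) counitA a *: b.

End Smash.

(* Main.v *)
Require Import Defs.
From HB Require Import structures.
From mathcomp Require Import all_boot all_algebra.

Set Implicit Arguments.
Unset Strict Implicit.
Unset Printing Implicit Defensive.

Import GRing.Theory.
Local Open Scope ring_scope.

(**
  Write H for the biproduct, pA = id ⊗ counitB and pB = counitA ⊗ id for its
  two projections, and index several copies of R by the pair of legs that they
  occupy in H ⊗ H ⊗ H ⊗ H. The counit axioms, of the smash coproduct and of A
  and B, give h = pA h1 ⊗ pB h2 for all h in H ([piA_piB_comul]), so R is
  recovered from its double coproduct: R = (pA ⊗ pB ⊗ pA ⊗ pB) (Δ ⊗ Δ) R. The
  two hexagon axioms turn (Δ ⊗ Δ) R into the product R14 R24 R13 R23, and it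
  remains to push the projections through that product.

  - Because sigma is right conormal, pB is an algebra map ([piB_mul]). The legs
    under pB therefore factor, which produces W and the products W1 Y1 and
    X2 W2.
  - The projection pA is not multiplicative, but pA (x y) depends on y only
    through pA y ([piA_mul_piA]). Under pA the right factor of a product may
    thus be replaced by an element of the subalgebra A.
  - Multiplying the first leg of R on the right by such an element a is
    governed by almost cocommutativity at h = a ⊗ 1: after projecting by
    pA ⊗ pB, the element moves to the left and picks up one tau
    ([qt_cop_left]). This is applied to R14 R13, and once more to split the
    second leg of the remaining R13 by pA and pB, which yields Z and the second
    copy of X ([tsum_qt_piA] and [tsum_qt_piA_split]).

  At this stage tau is evaluated at a product Z1_tau Xb1 in A, and sigma at a
  product 1_tau Xb2 in B. Since Δ is multiplicative and pB is an algebra map,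
  tau (a a' ⊗ 1) splits into two copies of tau ([tau_mul_unit]); associativity
  of the smash product splits sigma (b b' ⊗ a) in the same way ([sigma_mul]).
  Only a reordering of independent sums then separates both sides.

  Sums over tensors are evaluated by the universal property, which asks for the
  multilinearity of every summand; the tactic [multilinear] supplies it by
  recursion on the summand.
*)

(** * Multilinearity of iterated tensor sums *)

Section Multilinear.
Variable k : fieldType.
Implicit Types (T U V W M : lmodType k) (A : algType k).

Lemma linear_idfun U : linear (fun u : U => u).
Proof. by []. Qed.

Lemma linear_comp T U V (g : {linear U -> V}) (h : T -> U) :
  linear h -> linear (fun t => g (h t)).
Proof. by move=> hl c p q; rewrite hl linearP. Qed.

Lemma linear_tpurel T U V (h : T -> U) (v : V) :
  linear h -> linear (fun t => h t ⊗ v).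
Proof. by move=> hl c p q; rewrite hl (tpure_bilinear _ _).1. Qed.

Lemma linear_tpurer T U V (u : U) (h : T -> V) :
  linear h -> linear (fun t => u ⊗ h t).
Proof. by move=> hl c p q; rewrite hl (tpure_bilinear _ _).2. Qed.

Lemma linear_mull T A (h : T -> A) (y : A) :
  linear h -> linear (fun t => h t * y).
Proof. by move=> hl c p q; rewrite hl mulrDl scalerAl. Qed.

Lemma linear_mulr T A (x : A) (h : T -> A) :
  linear h -> linear (fun t => x * h t).
Proof. by move=> hl c p q; rewrite hl mulrDr scalerAr. Qed.

Lemma linear_scaler T U (a : k) (h : T -> U) :
  linear h -> linear (fun t => a *: h t).
Proof. by move=> hl c p q; rewrite hl scalerDr !scalerA mulrC. Qed.

Lemma linear_scalel T U V (e : {scalar U}) (h : T -> U) (v : V) :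
  linear h -> linear (fun t => e (h t) *: v).
Proof. by move=> hl c p q; rewrite hl linearP scalerDl scalerA. Qed.

Lemma linear_tlift T U V W (f : U -> V -> W) (h : T -> (U ⊗ V)%type) :
  linear h -> bilinear_map f -> linear (fun t => tlift f (h t)).
Proof. by move=> hl fb; apply: linear_tlift_comp. Qed.

(** Reduces bilinearity to goals in which the varying argument is the variable
    of a lambda, the form that the syntax-directed tactic below recognizes. *)
Lemma bilinear_map_sep U V W (f : U -> V -> W) :
  (forall v, linear (fun u => f u v)) -> (forall u, linear (f u)) ->
  bilinear_map f.
Proof. by move=> fl fr; split=> [v|u] c p q /=; rewrite ?fl ?fr. Qed.

Lemma linear_bilinear_map_l T U V W (f : U -> V -> W) (h : T -> U) v :
  bilinear_map f -> linear h -> linear (fun t => f (h t) v).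
Proof. by move=> [fl _] hl c p q; rewrite hl fl. Qed.

Lemma linear_bilinear_map_r T U V W (f : U -> V -> W) u (h : T -> V) :
  bilinear_map f -> linear h -> linear (fun t => f u (h t)).
Proof. by move=> [_ fr] hl c p q; rewrite hl fr. Qed.

Definition trilinear U V W M (f : U -> V -> W -> M) : Prop :=
  (forall w, bilinear_map (fun u v => f u v w)) /\
  (forall u, bilinear_map (f u)).

Lemma linear_trilinear1 T U V W M (f : U -> V -> W -> M) (h : T -> U) v w :
  trilinear f -> linear h -> linear (fun t => f (h t) v w).
Proof. by move=> [fl _] hl c p q; rewrite hl (fl w).1. Qed.

Lemma linear_trilinear2 T U V W M (f : U -> V -> W -> M) u (h : T -> V) w :
  trilinear f -> linear h -> linear (fun t => f u (h t) w).
Proof. by move=> [fl _] hl c p q; rewrite hl (fl w).2. Qed.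

Lemma linear_trilinear3 T U V W M (f : U -> V -> W -> M) u v (h : T -> W) :
  trilinear f -> linear h -> linear (fun t => f u v (h t)).
Proof. by move=> [_ fr] hl c p q; rewrite hl (fr u).2. Qed.

Lemma linear_smash_mull T (A B : algType k)
    (sigma : {linear (B ⊗ A)%type -> (A ⊗ B)%type})
    (h : T -> (A ⊗ B)%type) y :
  linear h -> linear (fun t => smash_mul sigma (h t) y).
Proof. by move=> hl c p q; rewrite hl (smash_mul_bilinear sigma).1. Qed.

Lemma linear_smash_mulr T (A B : algType k)
    (sigma : {linear (B ⊗ A)%type -> (A ⊗ B)%type})
    x (h : T -> (A ⊗ B)%type) :
  linear h -> linear (fun t => smash_mul sigma x (h t)).
Proof. by move=> hl c p q; rewrite hl (smash_mul_bilinear sigma).2. Qed.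

Lemma linear_smash_comul T (A B : algType k)
    (comulA : {linear A -> (A ⊗ A)%type})
    (comulB : {linear B -> (B ⊗ B)%type})
    (tau : {linear (A ⊗ B)%type -> (B ⊗ A)%type})
    (h : T -> (A ⊗ B)%type) :
  linear h -> linear (fun t => smash_comul comulA comulB tau (h t)).
Proof. by move=> hl c p q; rewrite hl smash_comul_linear. Qed.

Lemma linear_piA T (A B : algType k) (counitB : {scalar B})
    (h : T -> (A ⊗ B)%type) :
  linear h -> linear (fun t => piA counitB (h t)).
Proof.
move=> hl; apply: linear_tlift => //.
apply: bilinear_map_sep => [v|u]; [exact: linear_scaler|exact: linear_scalel].
Qed.

Lemma linear_piB T (A B : algType k) (counitA : {scalar A})
    (h : T -> (A ⊗ B)%type) :
  linear h -> linear (fun t => piB counitA (h t)).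
Proof.
move=> hl; apply: linear_tlift => //.
apply: bilinear_map_sep => [v|u]; [exact: linear_scalel|exact: linear_scaler].
Qed.

End Multilinear.

(** Each clause removes the head symbol of the summand. A pattern variable may
    capture a subterm in which t occurs, and the [apply] then fails; [match]
    rather than [lazymatch] lets the search go on to the clause for the other
    argument. The last clause eta-expands a partial application. *)
Ltac multilinear_step :=
  cbv beta;
  match goal with
  | |- trilinear _ => split; intro
  | |- bilinear_for _ _ _ => apply: bilinear_map_sep; intro
  | |- GRing.linear_for _ (fun t => t) => exact: linear_idfun
  | |- GRing.linear_for _ (fun t => tlift (@?f t) ?x) =>
      apply: (@linear_tlift_param _ _ _ _ _ f x); do 2 intro
  | |- GRing.linear_for _ (fun t => tlift ?f (@?x t)) =>
      apply: (@linear_tlift _ _ _ _ _ f x)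
  | |- GRing.linear_for _ (fun t => tpure (@?x t) ?v) =>
      apply: (@linear_tpurel _ _ _ _ x v)
  | |- GRing.linear_for _ (fun t => tpure ?u (@?x t)) =>
      apply: (@linear_tpurer _ _ _ _ u x)
  | |- GRing.linear_for _ (fun t => GRing.mul (@?x t) ?v) =>
      apply: (@linear_mull _ _ _ x v)
  | |- GRing.linear_for _ (fun t => GRing.mul ?u (@?x t)) =>
      apply: (@linear_mulr _ _ _ u x)
  | |- GRing.linear_for _ (fun t => GRing.scale (_ (@?x t)) ?v) =>
      apply: (@linear_scalel _ _ _ _ _ x v)
  | |- GRing.linear_for _ (fun t => GRing.scale ?u (@?x t)) =>
      apply: (@linear_scaler _ _ _ u x)
  | |- GRing.linear_for _ (fun t => GRing.Linear.sort ?g (@?x t)) =>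
      apply: (@linear_comp _ _ _ _ _ x)
  | |- GRing.linear_for _ (fun t => smash_mul _ (@?x t) ?v) =>
      apply: (@linear_smash_mull _ _ _ _ _ x v)
  | |- GRing.linear_for _ (fun t => smash_mul _ ?u (@?x t)) =>
      apply: (@linear_smash_mulr _ _ _ _ _ u x)
  | |- GRing.linear_for _ (fun t => smash_comul _ _ _ (@?x t)) =>
      apply: (@linear_smash_comul _ _ _ _ _ _ _ x)
  | |- GRing.linear_for _ (fun t => piA _ (@?x t)) =>
      apply: (@linear_piA _ _ _ _ _ x)
  | |- GRing.linear_for _ (fun t => piB _ (@?x t)) =>
      apply: (@linear_piB _ _ _ _ _ x)
  | fP : bilinear_for _ _ ?f |- GRing.linear_for _ (fun t => ?f (@?x t) ?v) =>
      apply: (@linear_bilinear_map_l _ _ _ _ _ f x v fP)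
  | fP : bilinear_for _ _ ?f |- GRing.linear_for _ (fun t => ?f ?u (@?x t)) =>
      apply: (@linear_bilinear_map_r _ _ _ _ _ f u x fP)
  | fP : trilinear ?f |- GRing.linear_for _ (fun t => ?f (@?x t) ?v ?w) =>
      apply: (@linear_trilinear1 _ _ _ _ _ _ f x v w fP)
  | fP : trilinear ?f |- GRing.linear_for _ (fun t => ?f ?u (@?x t) ?w) =>
      apply: (@linear_trilinear2 _ _ _ _ _ _ f u x w fP)
  | fP : trilinear ?f |- GRing.linear_for _ (fun t => ?f ?u ?v (@?x t)) =>
      apply: (@linear_trilinear3 _ _ _ _ _ _ f u v x fP)
  | |- @GRing.linear_for ?R ?U ?V ?s ?f =>
      lazymatch f with
      | fun _ => _ => fail
      | _ => change (@GRing.linear_for R U V s (fun t => f t))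
      end
  end.
Ltac multilinear := repeat multilinear_step; try done.

(** * Computing with tensor sums *)

Section Sums.
Variable k : fieldType.
Implicit Types (U V W M : lmodType k).

(** Stated for a plain function with a linearity proof, so that it applies to
    contexts that carry no bundled linear structure. *)
Lemma linear_tsum U V W M (g : W -> M) (f : U -> V -> W) x :
  linear g -> g (tlift f x) = \tsum_(u, v <- x) g (f u v).
Proof.
move=> gl; pose G := GRing.isLinear.Build k W M *:%R g gl.
pose g' : {linear W -> M} := HB.pack g G.
exact: (raddf_sum g').
Qed.

Lemma linear_scale U V (g : U -> V) c x : linear g -> g (c *: x) = c *: g x.
Proof.
move=> gl; have g0 : g 0 = 0 by have := gl (-1) 0 0; rewrite !scaleN1r !addNr.
by have := gl c x 0; rewrite g0 !addr0.
Qed.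

Lemma tpure_scalel U V c (u : U) (v : V) : (c *: u) ⊗ v = c *: (u ⊗ v).
Proof. by rewrite (linear_scale (g := fun u => u ⊗ v)) //; multilinear. Qed.

Lemma tpure_scaler U V c (u : U) (v : V) : u ⊗ (c *: v) = c *: (u ⊗ v).
Proof. by rewrite (linear_scale (g := fun v => u ⊗ v)) //; multilinear. Qed.

Lemma tsum_tsum U V U' V' M (f : U -> V -> M)
    (g : U' -> V' -> (U ⊗ V)%type) x :
  bilinear_map f ->
  tlift f (tlift g x) = \tsum_(u, v <- x) tlift f (g u v).
Proof. by move=> fb; apply: linear_tsum; apply: tlift_linear. Qed.

Lemma tsum_tmap U V U' V' M (f : U' -> V' -> M) (g : U -> U') (h : V -> V') x :
  bilinear_map f ->
  tlift f (tmap g h x) = \tsum_(u, v <- x) f (g u) (h v).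
Proof.
by move=> fb; rewrite tsum_tsum //; apply: eq_tlift => u v; rewrite tlift_pure.
Qed.

Lemma tsum_tswap U V M (f : V -> U -> M) (x : U ⊗ V) :
  bilinear_map f -> tlift f (tswap x) = \tsum_(u, v <- x) f v u.
Proof.
by move=> fb; rewrite tsum_tsum //; apply: eq_tlift => u v; rewrite tlift_pure.
Qed.

Lemma tsum_pure U V (x : U ⊗ V) : \tsum_(u, v <- x) u ⊗ v = x.
Proof. by rewrite [RHS]tens_sum_repr. Qed.

Lemma exchange_tsum U V U' V' M (f : U -> V -> U' -> V' -> M) x y :
  \tsum_(u, v <- x) \tsum_(u', v' <- y) f u v u' v' =
  \tsum_(u', v' <- y) \tsum_(u, v <- x) f u v u' v'.
Proof. exact: exchange_big. Qed.

Lemma tens_ext U V M (f g : (U ⊗ V)%type -> M) :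
  linear f -> linear g -> (forall u v, f (u ⊗ v) = g (u ⊗ v)) -> f =1 g.
Proof.
move=> fl gl fg x; rewrite -[x]tsum_pure !linear_tsum //.
exact: eq_tlift.
Qed.

End Sums.

(** Both sides being linear in x, it is enough to compare them on pure
    tensors. *)
Ltac tens_elim x :=
  pattern x;
  match goal with |- (fun t => @?f t = @?g t) x =>
    apply: (@tens_ext _ _ _ _ f g); [by multilinear|by multilinear|]
  end; cbv beta; clear x.

(** * The smash product and its projections *)

Lemma piA_pure (k : fieldType) (A B : algType k) (counitB : {scalar B}) a b :
  piA counitB (a ⊗ b : A ⊗ B) = counitB b *: a.
Proof. by rewrite /piA tlift_pure //; multilinear. Qed.

Lemma piB_pure (k : fieldType) (A B : algType k) (counitA : {scalar A}) a b :
  piB counitA (a ⊗ b : A ⊗ B) = counitA a *: b.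
Proof. by rewrite /piB tlift_pure //; multilinear. Qed.

Section SmashProduct.
Variables (k : fieldType) (A B : algType k).
Variables (counitA : {scalar A}) (counitB : {scalar B}).
Variable sigma : {linear (B ⊗ A)%type -> (A ⊗ B)%type}.
Hypothesis smash : is_smash_product sigma.
Hypotheses (counA : counital_algebra counitA)
  (counB : counital_algebra counitB).

Implicit Types (a : A) (b : B) (x y : (A ⊗ B)%type).

Local Notation "x ⋆ y" := (smash_mul sigma x y) (at level 40, left associativity).

Lemma smash_mul_pure a b a' b' :
  (a ⊗ b) ⋆ (a' ⊗ b') =
  \tsum_(a's, bs <- sigma (b ⊗ a')) (a * a's) ⊗ (bs * b').
Proof. by rewrite /smash_mul tlift_pure ?tlift_pure //; multilinear. Qed.

Lemma sigma_unitr b : sigma (b ⊗ 1) = 1 ⊗ b.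
Proof.
have := algebra_mul1r smash (1 ⊗ b); rewrite /smash_one /= smash_mul_pure => <-.
by rewrite -[LHS]tsum_pure; apply: eq_tlift => u v; rewrite mul1r mulr1.
Qed.

Lemma sigma_unitl a : sigma (1 ⊗ a) = a ⊗ 1.
Proof.
have := algebra_mul1l smash (a ⊗ 1); rewrite /smash_one /= smash_mul_pure => <-.
by rewrite -[LHS]tsum_pure; apply: eq_tlift => u v; rewrite mul1r mulr1.
Qed.

Lemma smash_mulA x y z : x ⋆ (y ⋆ z) = x ⋆ y ⋆ z.
Proof. exact: (algebra_mulA smash). Qed.

Lemma smash_mul1l x : (1 ⊗ 1) ⋆ x = x.
Proof. exact: (algebra_mul1l smash). Qed.

Lemma smash_mul1r x : x ⋆ (1 ⊗ 1) = x.
Proof. exact: (algebra_mul1r smash). Qed.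

Lemma smash_mul_left a a' b : (a ⊗ 1) ⋆ (a' ⊗ b) = (a * a') ⊗ b.
Proof.
by rewrite smash_mul_pure sigma_unitl tlift_pure ?mul1r //; multilinear.
Qed.

Lemma smash_mul_right a b b' : (a ⊗ b) ⋆ (1 ⊗ b') = a ⊗ (b * b').
Proof.
by rewrite smash_mul_pure sigma_unitr tlift_pure ?mulr1 //; multilinear.
Qed.

(** Associativity of the smash product at (1 ⊗ b) (1 ⊗ b') (a ⊗ 1), as
    sigma (b ⊗ a) is the product of 1 ⊗ b and a ⊗ 1. *)
Lemma sigma_mul b b' a :
  sigma ((b * b') ⊗ a) =
  \tsum_(a1, b1 <- sigma (b' ⊗ a)) \tsum_(a2, b2 <- sigma (b ⊗ a1))
    a2 ⊗ (b2 * b1).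
Proof.
have sE c d : (1 ⊗ c) ⋆ (d ⊗ 1) = sigma (c ⊗ d).
  rewrite smash_mul_pure -[RHS]tsum_pure; apply: eq_tlift => u v.
  by rewrite mul1r mulr1.
rewrite -sE -smash_mul_right -smash_mulA sE -{1}[sigma (b' ⊗ a)]tsum_pure.
rewrite (linear_tsum (g := smash_mul sigma (1 ⊗ b))); last by multilinear.
apply: eq_tlift => a1 b1; rewrite smash_mul_pure.
by apply: eq_tlift => a2 b2; rewrite mul1r.
Qed.

Lemma piA_mul_left a x : piA counitB ((a ⊗ 1) ⋆ x) = a * piA counitB x.
Proof.
tens_elim x => a' b.
by rewrite smash_mul_left !piA_pure scalerAr.
Qed.

(** In (a ⊗ b) (a' ⊗ b') the factor b' only multiplies on the far right of the
    B-component, where the algebra map counitB turns it into a scalar. *)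
Lemma piA_mul_piA x y :
  piA counitB (x ⋆ y) = piA counitB (x ⋆ (piA counitB y ⊗ 1)).
Proof.
tens_elim y => a' b'; tens_elim x => a b.
rewrite piA_pure tpure_scalel.
rewrite (linear_scale (g := fun z => piA counitB ((a ⊗ b) ⋆ z)));
  last by multilinear.
rewrite !smash_mul_pure !(linear_tsum (g := piA counitB)); [|by multilinear..].
rewrite (linear_tsum (g := fun x : A => counitB b' *: x)); last by multilinear.
apply: eq_tlift => u v; rewrite !piA_pure mulr1 counB.1.
by rewrite scalerA mulrC.
Qed.

Hypothesis conormal : right_conormal counitA sigma.

(** Conormality lets counitA erase the A-component that sigma has acted on,
    and sigma with it. *)
Lemma piB_mul x y : piB counitA (x ⋆ y) = piB counitA x * piB counitA y.
Proof.
tens_elim y => a' b'; tens_elim x => a b.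
rewrite !smash_mul_pure !piB_pure linear_tsum; last by multilinear.
rewrite -scalerAl -scalerAr [counitA a' *: _]scalerAl.
rewrite -[counitA a' *: b]conormal.
rewrite (linear_tsum (g := fun x : B => counitA a *: (x * b')));
  last by multilinear.
apply: eq_tlift => u v; rewrite !piB_pure counA.1.
by rewrite -scalerAl scalerA.
Qed.

End SmashProduct.

(** * The smash coproduct and its projections *)

Section Coalgebra.
Variables (k : fieldType) (H M : lmodType k).
Variables (comul : {linear H -> (H ⊗ H)%type}) (counit : {scalar H}).
Hypothesis coalg : is_coalgebra comul counit.

Lemma counitl_tsum (g : H -> M) h :
  linear g -> \tsum_(h1, h2 <- comul h) counit h1 *: g h2 = g h.
Proof.
move=> gl; rewrite -[in RHS](coalgebra_counitl coalg h) linear_tsum //.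
by apply: eq_tlift => u v; rewrite linear_scale.
Qed.

Lemma counitr_tsum (g : H -> M) h :
  linear g -> \tsum_(h1, h2 <- comul h) counit h2 *: g h1 = g h.
Proof.
move=> gl; rewrite -[in RHS](coalgebra_counitr coalg h) linear_tsum //.
by apply: eq_tlift => u v; rewrite linear_scale.
Qed.

End Coalgebra.

Section SmashCoproduct.
Variables (k : fieldType) (A B : algType k).
Variables (comulA : {linear A -> (A ⊗ A)%type}) (counitA : {scalar A}).
Variables (comulB : {linear B -> (B ⊗ B)%type}) (counitB : {scalar B}).
Variable tau : {linear (A ⊗ B)%type -> (B ⊗ A)%type}.
Hypothesis coalgA : is_coalgebra comulA counitA.
Hypothesis coalgB : is_coalgebra comulB counitB.
Hypothesis cosmash : is_smash_coproduct comulA counitA comulB counitB tau.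

Implicit Types (a : A) (b : B) (x y : (A ⊗ B)%type).
Local Notation comul := (smash_comul comulA comulB tau).

Lemma smash_counit_pure a b :
  smash_counit counitA counitB (a ⊗ b) = counitA a * counitB b.
Proof.
rewrite /smash_counit tlift_pure //; split=> [v|u] c p q /=.
  by rewrite linearP mulrDl -mulrA.
by rewrite linearP mulrDr mulrCA.
Qed.

Lemma tsum_smash_comul (M : lmodType k)
    (f : (A ⊗ B)%type -> (A ⊗ B)%type -> M) a b :
  bilinear_map f ->
  \tsum_(h1, h2 <- comul (a ⊗ b)) f h1 h2 =
  \tsum_(a1, a2 <- comulA a) \tsum_(b1, b2 <- comulB b)
    \tsum_(b1t, a2t <- tau (a2 ⊗ b1)) f (a1 ⊗ b1t) (a2t ⊗ b2).
Proof.
move=> fb; rewrite /smash_comul tlift_pure; last by multilinear.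
rewrite tsum_tsum //; apply: eq_tlift => a1 a2.
rewrite tsum_tsum //; apply: eq_tlift => b1 b2.
rewrite tsum_tsum //; apply: eq_tlift => b1t a2t.
by rewrite tlift_pure.
Qed.

(** This conormality of tau is the right counit axiom of the smash coproduct,
    seen through piB. *)
Lemma tau_counitA a b :
  \tsum_(bt, at_ <- tau (a ⊗ b)) counitA at_ *: bt = counitA a *: b.
Proof.
rewrite -piB_pure -[in RHS](coalgebra_counitr cosmash (a ⊗ b)) /=.
rewrite (linear_tsum (g := piB counitA)); last by multilinear.
rewrite tsum_smash_comul; last by multilinear.
rewrite -(counitl_tsum coalgA (g := fun a =>
  \tsum_(bt, at_ <- tau (a ⊗ b)) counitA at_ *: bt)); last by multilinear.
apply: eq_tlift => a1 a2.
rewrite -(counitr_tsum coalgB (g := fun b =>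
  \tsum_(bt, at_ <- tau (a2 ⊗ b)) counitA at_ *: bt)); last by multilinear.
rewrite (linear_tsum (g := fun z : B => counitA a1 *: z)); last by multilinear.
apply: eq_tlift => b1 b2.
rewrite (linear_tsum (g := fun z : B => counitA a1 *: (counitB b2 *: z)));
  last by multilinear.
apply: eq_tlift => bt at_; rewrite smash_counit_pure.
rewrite (linear_scale (g := piB counitA)); last by multilinear.
by rewrite piB_pure !scalerA; congr (_ *: _); rewrite mulrC mulrA mulrAC.
Qed.

Lemma tau_counitA_tsum (M : lmodType k) (g : B -> M) a b : linear g ->
  \tsum_(bt, at_ <- tau (a ⊗ b)) counitA at_ *: g bt = counitA a *: g b.
Proof.
move=> gl; rewrite -linear_scale // -tau_counitA linear_tsum //.
by apply: eq_tlift => bt at_; rewrite linear_scale.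
Qed.

(** Both counits fall on the two components produced by tau, where conormality
    removes tau; the counit axioms of A and B do the rest. *)
Lemma piA_piB_comul x : tmap (piA counitB) (piB counitA) (comul x) = x.
Proof.
rewrite /tmap; tens_elim x => a b.
rewrite tsum_smash_comul; last by multilinear.
rewrite -(counitr_tsum coalgA (g := fun a => a ⊗ b)); last by multilinear.
apply: eq_tlift => a1 a2.
rewrite -(counitl_tsum coalgB (g := fun b => counitA a2 *: (a1 ⊗ b)));
  last by multilinear.
apply: eq_tlift => b1 b2.
rewrite scalerA mulrC -scalerA -tpure_scalel.
rewrite -(tau_counitA_tsum (g := fun b => (counitB b *: a1) ⊗ b2));
  last by multilinear.
apply: eq_tlift => bt at_.
by rewrite piA_pure piB_pure tpure_scaler.
Qed.

(** Here the two projections keep exactly the components on which tau acts,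
    so the comultiplication of the biproduct determines tau. *)
Lemma tau_comul a b :
  tau (a ⊗ b) = tmap (piB counitA) (piA counitB) (comul (a ⊗ b)).
Proof.
rewrite /tmap tsum_smash_comul; last by multilinear.
rewrite -(counitl_tsum coalgA (g := fun a => tau (a ⊗ b))); last by multilinear.
apply: eq_tlift => a1 a2.
rewrite -(counitr_tsum coalgB (g := fun b => counitA a1 *: tau (a2 ⊗ b)));
  last by multilinear.
apply: eq_tlift => b1 b2.
rewrite -[X in _ *: (_ *: X) = _]tsum_pure.
rewrite (linear_tsum (g := fun z => counitB b2 *: (counitA a1 *: z)));
  last by multilinear.
apply: eq_tlift => bt at_.
by rewrite piA_pure piB_pure tpure_scalel tpure_scaler !scalerA mulrC.
Qed.

End SmashCoproduct.

(** * Consequences of the bialgebra axioms *)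

Section Biproduct.
Variables (k : fieldType) (A B : algType k).
Variables (comulA : {linear A -> (A ⊗ A)%type}) (counitA : {scalar A}).
Variables (comulB : {linear B -> (B ⊗ B)%type}) (counitB : {scalar B}).
Variable sigma : {linear (B ⊗ A)%type -> (A ⊗ B)%type}.
Variable tau : {linear (A ⊗ B)%type -> (B ⊗ A)%type}.
Hypothesis bialg :
  smash_biproduct_bialgebra comulA counitA comulB counitB sigma tau.
Hypothesis conormal : right_conormal counitA sigma.

Implicit Types (a : A) (b : B) (x y : (A ⊗ B)%type).
Local Notation comul := (smash_comul comulA comulB tau).
Local Notation "x ⋆ y" := (smash_mul sigma x y) (at level 40, left associativity).
Local Notation pA := (piA counitB).
Local Notation pB := (piB counitA).

Let smash := smash_product bialg.
Let cosmash := smash_coproduct bialg.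
Let coalgA := smash_coalgebraA bialg.
Let coalgB := smash_coalgebraB bialg.
Let counA := smash_counitalA bialg.
Let counB := smash_counitalB bialg.

Lemma tsum_comul_left (M : lmodType k)
    (f : (A ⊗ B)%type -> (A ⊗ B)%type -> M) a :
  bilinear_map f ->
  \tsum_(h1, h2 <- comul (a ⊗ 1)) f h1 h2 =
  \tsum_(a1, a2 <- comulA a) \tsum_(one_t, a2t <- tau (a2 ⊗ 1))
    f (a1 ⊗ one_t) (a2t ⊗ 1).
Proof.
move=> fb; rewrite tsum_smash_comul //; apply: eq_tlift => a1 a2.
by rewrite (smash_unitalB bialg).1 tlift_pure //; multilinear.
Qed.

Lemma tsum_tau (M : lmodType k) (f : B -> A -> M) a b :
  bilinear_map f ->
  \tsum_(bt, at_ <- tau (a ⊗ b)) f bt at_ =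
  \tsum_(h1, h2 <- comul (a ⊗ b)) f (pB h1) (pA h2).
Proof.
by move=> fb; rewrite (tau_comul tau coalgA coalgB) tsum_tmap.
Qed.

(** By [tau_comul], tau (a ⊗ 1) is the image of Δ (a ⊗ 1) under pB ⊗ pA, and Δ
    is multiplicative. The map pA multiplies correctly here because the second
    leg of Δ (a ⊗ 1) lies in A ⊗ 1. *)
Lemma tau_mul_unit a a' :
  tau ((a * a') ⊗ 1) =
  \tsum_(one_t, a_t <- tau (a ⊗ 1)) \tsum_(one_t', a'_t <- tau (a' ⊗ 1))
    (one_t * one_t') ⊗ (a_t * a'_t).
Proof.
rewrite -[LHS]tsum_pure tsum_tau; last by multilinear.
rewrite -(smash_mul_left smash) (bialgebra_comulM (smash_bialgebra bialg)) /=.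
rewrite /tmul tsum_tsum; last by multilinear.
rewrite tsum_comul_left; last by multilinear.
rewrite -(counitl_tsum coalgA (g := fun a => \tsum_(one_t, a_t <- tau (a ⊗ 1))
  \tsum_(one_t', a'_t <- tau (a' ⊗ 1)) (one_t * one_t') ⊗ (a_t * a'_t)));
  last by multilinear.
apply: eq_tlift => a1 a2.
rewrite (linear_tsum (g := fun z => counitA a1 *: z)); last by multilinear.
apply: eq_tlift => one_t a_t.
rewrite tsum_tsum; last by multilinear.
rewrite tsum_tau; last by multilinear.
rewrite (linear_tsum (g := fun z => counitA a1 *: z)); last by multilinear.
apply: eq_tlift => h1 h2.
rewrite tlift_pure; last by multilinear.
rewrite (piB_mul counA conormal) (piA_mul_left _ smash) piB_pure.
by rewrite -scalerAl tpure_scalel.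
Qed.

Lemma tmul_pure x y x' y' :
  tmul (smash_mul sigma) (smash_mul sigma) (x ⊗ y) (x' ⊗ y') =
  (x ⋆ x') ⊗ (y ⋆ y').
Proof. by rewrite /tmul !tlift_pure //; multilinear. Qed.

Lemma tsum_tmul (M : lmodType k)
    (f : (A ⊗ B)%type -> (A ⊗ B)%type -> M) p q :
  bilinear_map f ->
  tlift f (tmul (smash_mul sigma) (smash_mul sigma) p q) =
  \tsum_(x, y <- p) \tsum_(x', y' <- q) f (x ⋆ x') (y ⋆ y').
Proof.
move=> fb; rewrite /tmul tsum_tsum //; apply: eq_tlift => x y.
by rewrite tsum_tsum //; apply: eq_tlift => x' y'; rewrite tlift_pure.
Qed.

Lemma mul3_leg13_leg23 R :
  mul3 (smash_mul sigma) (leg13 (1 ⊗ 1) R) (leg23 (1 ⊗ 1) R) =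
  \tsum_(r, s <- R) \tsum_(r', s' <- R) r ⊗ (r' ⊗ (s ⋆ s')).
Proof.
rewrite /mul3 /mul2 /leg13 /leg23 /= {1}/tmul /=.
rewrite tsum_tsum; last by rewrite /tmul; multilinear.
apply: eq_tlift => r s.
rewrite tlift_pure; last by rewrite /tmul; multilinear.
rewrite tsum_tsum; last by rewrite /tmul; multilinear.
apply: eq_tlift => r' s'.
rewrite tlift_pure; last by rewrite /tmul; multilinear.
by rewrite tmul_pure (smash_mul1l smash) (smash_mul1r smash).
Qed.

Lemma mul3_leg13_leg12 R :
  mul3 (smash_mul sigma) (leg13 (1 ⊗ 1) R) (leg12 (1 ⊗ 1) R) =
  \tsum_(r, s <- R) \tsum_(r', s' <- R) (r ⋆ r') ⊗ (s' ⊗ s).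
Proof.
rewrite /mul3 /mul2 /leg13 /leg12 /= {1}/tmul /=.
rewrite tsum_tsum; last by rewrite /tmul; multilinear.
apply: eq_tlift => r s.
rewrite tlift_pure; last by rewrite /tmul; multilinear.
rewrite tsum_tsum; last by rewrite /tmul; multilinear.
apply: eq_tlift => r' s'.
rewrite tlift_pure; last by rewrite /tmul; multilinear.
by rewrite tmul_pure (smash_mul1l smash) (smash_mul1r smash).
Qed.

(** The recovery of an element from its coproduct, applied to a product. The
    left factor must stay inside pA, since only the right one can be replaced
    by its projection. *)
Lemma smash_mul_split x y :
  x ⋆ y = \tsum_(x1, x2 <- comul x) \tsum_(y1, y2 <- comul y)
    pA (x1 ⋆ (pA y1 ⊗ 1)) ⊗ (pB x2 * pB y2).
Proof.
rewrite -[LHS](piA_piB_comul coalgA coalgB cosmash).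
rewrite (bialgebra_comulM (smash_bialgebra bialg)) /= /tmap tsum_tmul;
  last by multilinear.
apply: eq_tlift => x1 x2; apply: eq_tlift => y1 y2.
by rewrite (piA_mul_piA sigma counB) (piB_mul counA conormal).
Qed.

Lemma piA_mul_pure_right a b b' a' :
  pA ((a ⊗ (b * b')) ⋆ (a' ⊗ 1)) =
  \tsum_(a's, b's <- sigma (b' ⊗ a')) \tsum_(a'ss, bs <- sigma (b ⊗ a's))
    counitB (bs * b's) *: (a * a'ss).
Proof.
rewrite smash_mul_pure (sigma_mul smash) tsum_tsum; last by multilinear.
rewrite linear_tsum; last by multilinear.
apply: eq_tlift => a's b's; rewrite tsum_tsum; last by multilinear.
rewrite linear_tsum; last by multilinear.
apply: eq_tlift => a'ss bs; rewrite tlift_pure; last by multilinear.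
by rewrite piA_pure mulr1.
Qed.

(** * Projecting the quasitriangularity axioms *)

Section Quasitriangular.
Variable R : (A ⊗ B) ⊗ (A ⊗ B).
Hypothesis quasiR : quasitriangular (smash_mul sigma) (smash_one A B)
  (smash_comul comulA comulB tau) (smash_counit counitA counitB) R.

(** The hexagon axiom is an identity between threefold tensors, and a trilinear
    f induces a linear map on those. *)
Lemma tsum_qt_comull (M : lmodType k)
    (f : (A ⊗ B)%type -> (A ⊗ B)%type -> (A ⊗ B)%type -> M) :
  trilinear f ->
  \tsum_(r, s <- R) \tsum_(r1, r2 <- comul r) f r1 r2 s =
  \tsum_(r, s <- R) \tsum_(r', s' <- R) f r r' (s ⋆ s').
Proof.
move=> fP.
pose F t := \tsum_(x, yz <- t) \tsum_(y, z <- yz) f x y z.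
have Fl : linear F by rewrite /F; multilinear.
have FE x y z : F (x ⊗ (y ⊗ z)) = f x y z.
  by rewrite /F tlift_pure ?tlift_pure //; multilinear.
have := congr1 F (qt_comull quasiR).
rewrite mul3_leg13_leg23 /tassoc tsum_tmap /=; last by multilinear.
rewrite !(linear_tsum _ _ Fl) => E.
transitivity (\tsum_(r, s <- R) F (\tsum_(r1, r2 <- comul r) r1 ⊗ (r2 ⊗ s))).
  apply: eq_tlift => r s; rewrite linear_tsum //; apply: eq_tlift => r1 r2.
  by rewrite FE.
rewrite E; apply: eq_tlift => r s; rewrite linear_tsum //.
by apply: eq_tlift => r' s'; rewrite FE.
Qed.

Lemma tsum_qt_comulr (M : lmodType k)
    (f : (A ⊗ B)%type -> (A ⊗ B)%type -> (A ⊗ B)%type -> M) :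
  trilinear f ->
  \tsum_(r, s <- R) \tsum_(s1, s2 <- comul s) f r s1 s2 =
  \tsum_(r, s <- R) \tsum_(r', s' <- R) f (r ⋆ r') s' s.
Proof.
move=> fP.
pose F t := \tsum_(x, yz <- t) \tsum_(y, z <- yz) f x y z.
have Fl : linear F by rewrite /F; multilinear.
have FE x y z : F (x ⊗ (y ⊗ z)) = f x y z.
  by rewrite /F tlift_pure ?tlift_pure //; multilinear.
have := congr1 F (qt_comulr quasiR).
rewrite mul3_leg13_leg12 {1}/F tsum_tmap /=; last by multilinear.
rewrite (linear_tsum _ _ Fl) => ->; apply: eq_tlift => r s.
by rewrite linear_tsum //; apply: eq_tlift => r' s'; rewrite FE.
Qed.

(** Almost cocommutativity at a ⊗ 1, projected by pA ⊗ pB. On the left, pB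
    sends the second leg of Δ (a ⊗ 1) to a scalar, so only the factor a ⊗ 1 of
    the first leg remains. On the right, the flipped coproduct meets
    pA ⊗ pB exactly as in [tau_comul], leaving tau (a ⊗ 1). *)
Lemma qt_cop_left a :
  \tsum_(r, s <- R) pA (r ⋆ (a ⊗ 1)) ⊗ pB s =
  \tsum_(one_t, a_t <- tau (a ⊗ 1)) \tsum_(r, s <- R)
    (a_t * pA r) ⊗ (one_t * pB s).
Proof.
have := congr1 (tmap pA pB) (qt_cop quasiR (a ⊗ 1)).
rewrite /mul2 /tmap /= !tsum_tmul ?tsum_tswap; [|by multilinear..].
rewrite tsum_comul_left; last by multilinear.
move=> E; transitivity (\tsum_(r, s <- R) \tsum_(h1, h2 <- comul (a ⊗ 1))
    pA (r ⋆ h1) ⊗ pB (s ⋆ h2)).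
  apply: eq_tlift => r s; rewrite tsum_comul_left; last by multilinear.
  rewrite -(counitr_tsum coalgA (g := fun a => pA (r ⋆ (a ⊗ 1)) ⊗ pB s));
    last by multilinear.
  apply: eq_tlift => a1 a2.
  rewrite -(tau_counitA_tsum coalgA coalgB cosmash
    (g := fun b => pA (r ⋆ (a1 ⊗ b)) ⊗ pB s)); last by multilinear.
  apply: eq_tlift => one_t a2_t.
  by rewrite (piB_mul counA conormal) piB_pure -scalerAr mulr1 tpure_scaler.
rewrite E -(counitl_tsum coalgA (g := fun a =>
  \tsum_(one_t, a_t <- tau (a ⊗ 1)) \tsum_(r, s <- R)
    (a_t * pA r) ⊗ (one_t * pB s))); last by multilinear.
apply: eq_tlift => a1 a2.
rewrite (linear_tsum (g := fun z => counitA a1 *: z)); last by multilinear.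
apply: eq_tlift => one_t a2_t.
rewrite (linear_tsum (g := fun z => counitA a1 *: z)); last by multilinear.
apply: eq_tlift => r s.
rewrite (piB_mul counA conormal) (piA_mul_left _ smash) piB_pure.
by rewrite -scalerAl tpure_scaler.
Qed.

(** The hexagon R13 R12 with pA on leg 1 and pB on leg 3. Under pA the factor
    from R12 may be replaced by its projection to A, which [qt_cop_left] then
    moves across R13. *)
Lemma tsum_qt_piA (M : lmodType k) (f : A -> (A ⊗ B)%type -> B -> M) :
  trilinear f ->
  \tsum_(r, s <- R) \tsum_(s1, s2 <- comul s) f (pA r) s1 (pB s2) =
  \tsum_(r, s <- R) \tsum_(one_t, r_t <- tau (pA r ⊗ 1)) \tsum_(x, y <- R)
    f (r_t * pA x) s (one_t * pB y).
Proof.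
move=> fP.
rewrite (tsum_qt_comulr (f := fun x y z => f (pA x) y (pB z)));
  last by multilinear.
rewrite exchange_tsum; apply: eq_tlift => r s.
transitivity (\tsum_(u, v <- \tsum_(x, y <- R) pA (x ⋆ (pA r ⊗ 1)) ⊗ pB y)
  f u s v).
  rewrite tsum_tsum; last by multilinear.
  apply: eq_tlift => x y; rewrite tlift_pure; last by multilinear.
  by rewrite (piA_mul_piA sigma counB).
rewrite qt_cop_left tsum_tsum; last by multilinear.
apply: eq_tlift => one_t r_t.
rewrite tsum_tsum; last by multilinear.
by apply: eq_tlift => x y; rewrite tlift_pure; last by multilinear.
Qed.

(** The same hexagon with pB on leg 1, where multiplicativity of pB is enough
    and no tau appears. *)
Lemma tsum_qt_piB (M : lmodType k) (f : B -> A -> B -> M) :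
  trilinear f ->
  \tsum_(r, s <- R) \tsum_(s1, s2 <- comul s) f (pB r) (pA s1) (pB s2) =
  \tsum_(w, v <- R) \tsum_(x, y <- R) f (pB w * pB x) (pA y) (pB v).
Proof.
move=> fP.
rewrite (tsum_qt_comulr (f := fun x y z => f (pB x) (pA y) (pB z)));
  last by multilinear.
apply: eq_tlift => r s; apply: eq_tlift => r' s'.
by rewrite (piB_mul counA conormal).
Qed.

(** [tsum_qt_piA] with the second leg of R split into its two projections; this
    expresses (pA ⊗ id) R through Z, X and tau alone. *)
Lemma tsum_qt_piA_split (M : lmodType k) (F : A -> (A ⊗ B)%type -> M) :
  bilinear_map F ->
  \tsum_(r, s <- R) F (pA r) s =
  \tsum_(r, s <- R) \tsum_(one_t, r_t <- tau (pA r ⊗ 1)) \tsum_(x, y <- R)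
    F (r_t * pA x) (pA s ⊗ (one_t * pB y)).
Proof.
move=> FP.
rewrite -(tsum_qt_piA (f := fun a h b => F a (pA h ⊗ b)));
  last by multilinear.
apply: eq_tlift => r s.
rewrite -[s in LHS](piA_piB_comul coalgA coalgB cosmash) /tmap.
by rewrite linear_tsum; last by multilinear.
Qed.

Lemma qt_split_left :
  R = \tsum_(r, s <- R) \tsum_(r', s' <- R)
    (pA r ⊗ pB r') ⊗ (s ⋆ s').
Proof.
rewrite -(tsum_qt_comull (f := fun x y z => (pA x ⊗ pB y) ⊗ z));
  last by multilinear.
rewrite -[LHS]tsum_pure; apply: eq_tlift => r s.
rewrite -[in LHS](piA_piB_comul coalgA coalgB cosmash r) /tmap.
by rewrite (linear_tsum (g := fun z => z ⊗ s)); last by multilinear.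
Qed.

(** The product R14 R24 R13 R23 under the four projections, with R24 and R23
    already evaluated: they contribute the factors w ⊗ v and x ⊗ y. The
    remaining coproduct on s still stands for the pair R14, R13. *)
Lemma qt_split_both :
  R = \tsum_(r, s <- R) \tsum_(s1, s2 <- comul s)
      \tsum_(w, v <- R) \tsum_(x, y <- R)
    (pA r ⊗ (pB w * pB x)) ⊗ (pA (s1 ⋆ (pA y ⊗ 1)) ⊗ (pB s2 * pB v)).
Proof.
rewrite [LHS]qt_split_left; apply: eq_tlift => r s.
transitivity (\tsum_(s1, s2 <- comul s) \tsum_(r', s' <- R)
    \tsum_(s'1, s'2 <- comul s') (pA r ⊗ pB r') ⊗
      (pA (s1 ⋆ (pA s'1 ⊗ 1)) ⊗ (pB s2 * pB s'2))).
  rewrite exchange_tsum; apply: eq_tlift => r' s'; rewrite smash_mul_split.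
  rewrite linear_tsum; last by multilinear.
  apply: eq_tlift => s1 s2.
  by rewrite linear_tsum; last by multilinear.
apply: eq_tlift => s1 s2.
by rewrite (tsum_qt_piB (f := fun b a b' => (pA r ⊗ b) ⊗
  (pA (s1 ⋆ (a ⊗ 1)) ⊗ (pB s2 * b')))); last by multilinear.
Qed.

(** The formula of the theorem before sigma is expanded, its sums listed in the
    order in which they arise. *)
Lemma qt_split_tau :
  R = \tsum_(z, z' <- R) \tsum_(one_t1, z_t1 <- tau (pA z ⊗ 1))
      \tsum_(xb, xb' <- R) \tsum_(one_t2, z_t1t2 <- tau (z_t1 ⊗ 1))
      \tsum_(one_t3, xb_t3 <- tau (pA xb ⊗ 1)) \tsum_(x, x' <- R)
      \tsum_(w, w' <- R) \tsum_(y, y' <- R)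
        (z_t1t2 * xb_t3 * pA x ⊗ (pB w * pB y)) ⊗
          (pA (pA z' ⊗ (one_t1 * pB xb') ⋆ (pA y' ⊗ 1)) ⊗
             (one_t2 * one_t3 * pB x' * pB w')).
Proof.
rewrite [LHS]qt_split_both.
rewrite (tsum_qt_piA (f := fun a h b => \tsum_(w, w' <- R) \tsum_(y, y' <- R)
  (a ⊗ (pB w * pB y)) ⊗ (pA (h ⋆ (pA y' ⊗ 1)) ⊗ (b * pB w'))));
    last by multilinear.
rewrite (tsum_qt_piA_split (F := fun a h => \tsum_(one_t, a_t <- tau (a ⊗ 1))
  \tsum_(x, x' <- R) \tsum_(w, w' <- R) \tsum_(y, y' <- R)
  (a_t * pA x ⊗ (pB w * pB y)) ⊗
    (pA (h ⋆ (pA y' ⊗ 1)) ⊗ (one_t * pB x' * pB w')))); last by multilinear.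
apply: eq_tlift => z z'; apply: eq_tlift => one_t1 z_t1.
apply: eq_tlift => xb xb'.
rewrite tau_mul_unit tsum_tsum; last by multilinear.
apply: eq_tlift => one_t2 z_t1t2.
rewrite tsum_tsum; last by multilinear.
apply: eq_tlift => one_t3 xb_t3.
by rewrite tlift_pure; last by multilinear.
Qed.

End Quasitriangular.

End Biproduct.

(** * The factorization formula *)

(** Exchanges two adjacent independent sums below n outer ones on the left of
    an equation whose right side is fixed. *)
Tactic Notation "swap_at" int_or_var(n) :=
  etransitivity; [do n (apply: eq_tlift => ? ?); apply: exchange_tsum|].

Theorem proposition3p4 (k : fieldType) (A B : algType k)
    (comulA : {linear A -> (A ⊗ A)%type}) (counitA : {scalar A})
    (comulB : {linear B -> (B ⊗ B)%type}) (counitB : {scalar B})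
    (sigma : {linear (B ⊗ A)%type -> (A ⊗ B)%type})
    (tau : {linear (A ⊗ B)%type -> (B ⊗ A)%type})
    (smashAB :
      smash_biproduct_bialgebra comulA counitA comulB counitB sigma tau)
    (sigma_conormal : right_conormal counitA sigma)
    (R : (A ⊗ B) ⊗ (A ⊗ B))
    (quasiR : quasitriangular (smash_mul sigma) (smash_one A B)
      (smash_comul comulA comulB tau) (smash_counit counitA counitB) R)
    (W : B ⊗ B) (X : A ⊗ B) (Y : B ⊗ A) (Z : A ⊗ A)
    (factorW : W = tmap (piB counitA) (piB counitA) R)
    (factorX : X = tmap (piA counitB) (piB counitA) R)
    (factorY : Y = tmap (piB counitA) (piA counitB) R)
    (factorZ : Z = tmap (piA counitB) (piA counitB) R) :
  R = \tsum_(W1, W2 <- W) \tsum_(X1, X2 <- X) \tsum_(Xb1, Xb2 <- X)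
      \tsum_(Y1, Y2 <- Y) \tsum_(Z1, Z2 <- Z)
      \tsum_(one_t1, Z1_t1 <- tau (Z1 ⊗ 1))
      \tsum_(one_t2, Z1_t1t2 <- tau (Z1_t1 ⊗ 1))
      \tsum_(one_t3, Xb1_t3 <- tau (Xb1 ⊗ 1))
      \tsum_(Y2_s1, Xb2_s1 <- sigma (Xb2 ⊗ Y2))
      \tsum_(Y2_s1s2, one_t1s2 <- sigma (one_t1 ⊗ Y2_s1))
        (Z1_t1t2 * Xb1_t3 * X1 ⊗ (W1 * Y1))
          ⊗ (counitB (one_t1s2 * Xb2_s1) *: (Z2 * Y2_s1s2)
              ⊗ (one_t2 * one_t3 * X2 * W2)).
Proof.
rewrite factorW factorX factorY factorZ.
transitivity (\tsum_(w, w' <- R) \tsum_(x, x' <- R) \tsum_(xb, xb' <- R)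
  \tsum_(y, y' <- R) \tsum_(z, z' <- R)
  \tsum_(one_t1, z_t1 <- tau (piA counitB z ⊗ 1))
  \tsum_(one_t2, z_t1t2 <- tau (z_t1 ⊗ 1))
  \tsum_(one_t3, xb_t3 <- tau (piA counitB xb ⊗ 1))
    (z_t1t2 * xb_t3 * piA counitB x ⊗ (piB counitA w * piB counitA y)) ⊗
    (piA counitB (smash_mul sigma
        (piA counitB z' ⊗ (one_t1 * piB counitA xb')) (piA counitB y' ⊗ 1)) ⊗
      (one_t2 * one_t3 * piB counitA x' * piB counitA w'))); last first.
  (* Each factor element is an image of R, so its sum becomes a sum over R. *)
  do 5! (rewrite tsum_tmap; [apply: eq_tlift => ? ? | by multilinear]).
  do 3! (apply: eq_tlift => ? ?).
  rewrite (piA_mul_pure_right smashAB).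
  rewrite (linear_tsum (g := fun u => _ ⊗ (u ⊗ _))); last by multilinear.
  apply: eq_tlift => ? ?.
  rewrite (linear_tsum (g := fun u => _ ⊗ (u ⊗ _))); last by multilinear.
  by [].
apply: (etrans (qt_split_tau smashAB sigma_conormal quasiR)); symmetry.
(* Each line brings to the front the sum that comes next in qt_split_tau. *)
swap_at 3; swap_at 2; swap_at 1; swap_at 0; apply: eq_tlift => z z'.
swap_at 3; swap_at 2; swap_at 1; swap_at 0; apply: eq_tlift => one_t1 z_t1.
swap_at 1; swap_at 0; apply: eq_tlift => xb xb'.
swap_at 2; swap_at 1; swap_at 0; apply: eq_tlift => one_t2 z_t1t2.
swap_at 2; swap_at 1; swap_at 0; apply: eq_tlift => one_t3 xb_t3.
exact: exchange_tsum.
Qed.
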